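(* Let $\mathcal{E}$ be a coarse structure on a non-empty set $X$. (a) $\mathcal{E}$ has a totally ordered base $\mathcal{B}$ (with respect to inclusion) if and only if there is a meet-complete totally ordered set $\mathcal{I}$ and a coarse $\mathcal{I}$-metric $\mathbf{d}$ on $X$ with $\mathcal{E}=\mathcal{E}_{\mathbf{d}}$. In this case, $(\mathcal{I},\mathbf{d})$ can be chosen to be $(\overline{\mathcal{B}},\mathbf{d}^{\mathcal{B}})$. (b) Suppose that $\mathcal{E}$ admits a totally ordered base $\mathcal{B}$. Then $\check{\mathbf{d}}^{\mathcal{B}}$ is a coarse $\overline{\mathcal{B}}$-metric on $\mathcal{P}_0(X)$, and the coarse structure induced by $\check{\mathbf{d}}^{\mathcal{B}}$ is precisely the Hausdorff coarse structure associated with $\mathcal{E}$.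
   Context: For a set $X$, $\mathcal{P}_0(X)$ is the collection of non-empty subsets of $X$ and $\Delta_X=\{(x,x):x\in X\}$. For $A,B\subseteq X\times X$: $A^{-1}=\{(y,x):(x,y)\in A\}$, $A\circ B=\{(x,z):\exists y\in X,\ (x,y)\in A,\ (y,z)\in B\}$, and for $S\subseteq X$, $B[S]=\{y\in X:(x,y)\in B\text{ for some }x\in S\}$, $B[x]=B[\{x\}]$. A coarse structure on $X$ is a collection $\mathcal{E}\subseteq\mathcal{P}_0(X\times X)$ with $\Delta_X\in\mathcal{E}$ that is closed under the formation of (non-empty) subsets, inverses, products $\circ$ (whenever non-empty) and finite unions. A subcollection $\mathcal{B}\subseteq\mathcal{E}$ is a base for $\mathcal{E}$ if every element of $\mathcal{E}$ is contained in an element of $\mathcal{B}$. A partially ordered set $\mathcal{I}$ is meet-complete if every non-empty subset has a greatest lower bound in $\mathcal{I}$; its zero is its smallest element $0_{\mathcal{I}}$. $\mathcal{I}_\infty$ is $\mathcal{I}$ with a new element $\infty$ adjoined that is strictly larger than all elements of $\mathcal{I}$. For a map $\mathbf{d}:X\times X\to\mathcal{I}_\infty$ and $\alpha\in\mathcal{I}$ put $\mathbf{D}_\alpha=\{(x,y)\in X\times X:\mathbf{d}(x,y)\le\alpha\}$ and $\mathbf{D}(z,\alpha)=\mathbf{D}_\alpha[z]$ for $z\in X$. For $\mathcal{I}$ upward directed (any two elements have an upper bound) with a zero, $\mathbf{d}$ is a coarse $\mathcal{I}$-metric if $\mathbf{d}(x,x)=0_{\mathcal{I}}$ and $\mathbf{d}(x,y)=\mathbf{d}(y,x)$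 for all $x,y$, and there is a function $\Phi:\mathcal{I}\to\mathcal{I}$ with $\mathbf{D}_\alpha\circ\mathbf{D}_\alpha\subseteq\mathbf{D}_{\Phi(\alpha)}$ for all $\alpha\in\mathcal{I}$. The coarse structure $\mathcal{E}_{\mathbf{d}}$ induced by a coarse $\mathcal{I}$-metric $\mathbf{d}$ is the one having $\{\mathbf{D}_\alpha:\alpha\in\mathcal{I}\}$ as a base. For a base $\mathcal{B}$ of $\mathcal{E}$: $\mathcal{B}_{\mathrm{s}}=\{(A\cap A^{-1})\cup\Delta_X:A\in\mathcal{B}\}$; $\overline{\mathcal{B}}=\{\bigcap\mathcal{S}:\emptyset\ne\mathcal{S}\subseteq\mathcal{B}_{\mathrm{s}}\}$, ordered by inclusion; and $\mathbf{d}^{\mathcal{B}}:X\times X\to\overline{\mathcal{B}}_\infty$ is $\mathbf{d}^{\mathcal{B}}(x,y)=\bigcap\{D\in\overline{\mathcal{B}}:(x,y)\in D\}$, with the convention $\bigcap\emptyset=\infty$. For $\mathcal{I}$ meet-complete and $\mathbf{d}$ a coarse $\mathcal{I}$-metric on $X$, $\check{\mathbf{d}}(R,S)=\inf\{\alpha\in\mathcal{I}:R\subseteq\bigcup_{s\in S}\mathbf{D}(s,\alpha)\text{ and }S\subseteq\bigcup_{r\in R}\mathbf{D}(r,\alpha)\}$ for $R,S\in\mathcal{P}_0(X)$, with $\inf\emptyset=\infty$; $\check{\mathbf{d}}^{\mathcal{B}}$ is this construction applied to $\mathbf{d}^{\mathcal{B}}$ (with $\mathcal{I}=\overline{\mathcal{B}}$).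 Let $\mathcal{I}^{\mathcal{E}}=\{E\in\mathcal{E}:E^{-1}=E,\ \Delta_X\subseteq E\}$ and, for $E\in\mathcal{I}^{\mathcal{E}}$, $\check E=\{(R,S)\in\mathcal{P}_0(X)\times\mathcal{P}_0(X):R\subseteq E[S]\text{ and }S\subseteq E[R]\}$. The Hausdorff coarse structure associated with $\mathcal{E}$ is the coarse structure on $\mathcal{P}_0(X)$ generated by $\{\check E:E\in\mathcal{I}^{\mathcal{E}}\}$ (the smallest one containing it). *)

(* Defs.v *)
From HB Require Import structures.
From mathcomp Require Import all_boot all_order.
From mathcomp Require Import boolp classical_sets.

Set Implicit Arguments.
Unset Strict Implicit.
Unset Printing Implicit Defensive.

Import Order.TTheory.
Local Open Scope classical_set_scope.
Local Open Scope relation_scope.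

(** ** Coarse structures *)

Definition nonempty_set (X : Type) := set_type [set A : set X | A !=set0].

(* [A `o B] runs through [A] first, whereas [B \; A] of [relation_scope]
   is written in the opposite order. *)
Definition rel_comp (X : Type) (A B : set (X * X)) : set (X * X) := B \; A.

Definition rel_image (X : Type) (A : set (X * X)) (S : set X) : set X :=
  [set y | exists2 x, S x & A (x, y)].

Record coarse_structure (X : Type) (E : set (set (X * X))) : Prop :=
  CoarseStructure {
    coarse_nonempty : forall A, E A -> A !=set0;
    coarse_diagonal : E diagonal;
    coarse_subset : forall A B, E A -> B `<=` A -> B !=set0 -> E B;
    coarse_inv : forall A, E A -> E A^-1;
    coarse_comp : forall A B, E A -> E B ->
      rel_comp A B !=set0 -> E (rel_comp A B);
    coarse_setU : forall A B, E A -> E B -> E (A `|` B) }.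

Definition coarse_base (X : Type) (E B : set (set (X * X))) : Prop :=
  B `<=` E /\ forall A, E A -> exists2 C, B C & A `<=` C.

Definition totally_ordered_base (X : Type) (E B : set (set (X * X))) : Prop :=
  coarse_base E B /\ total_on B subset.

(** ** Adjoining a largest element *)

(* [None] is the adjoined element, [Some] the embedding. *)
Definition adjoin_top (T : Type) : Type := option T.

Section AdjoinTop.
Context {disp : Order.disp_t} {I : porderType disp}.

Definition adjoin_top_le (a b : adjoin_top I) : bool :=
  match a, b with
  | _, None => true
  | None, Some _ => false
  | Some x, Some y => (x <= y)%O
  end.

Fact adjoin_top_le_refl : reflexive adjoin_top_le.
Proof. by case=> [x|] //=. Qed.

Fact adjoin_top_le_anti : antisymmetric adjoin_top_le.
Proof. by move=> [x|] [y|] //= /le_anti ->. Qed.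

Fact adjoin_top_le_trans : transitive adjoin_top_le.
Proof. by move=> [y|] [x|] [z|] //=; apply: le_trans. Qed.

HB.instance Definition _ := Choice.copy (adjoin_top I) (option I).
HB.instance Definition _ := Order.Le_isPOrder.Build disp (adjoin_top I)
  adjoin_top_le_refl adjoin_top_le_anti adjoin_top_le_trans.

(* The greatest lower bound is taken in the enlarged order, where that of the
   empty set is the adjoined element; [inf_topE] shows that on non-empty
   subsets it is the greatest lower bound in [I]. *)
Definition inf_top (A : set I) : adjoin_top I :=
  infimum (None : adjoin_top I) [set (Some a : adjoin_top I) | a in A].

Lemma inf_top0 : inf_top set0 = None.
Proof. by rewrite /inf_top image_set0 /infimum eqxx. Qed.

Lemma inf_topE (A : set I) (a : I) :
  A !=set0 -> infimums A a -> inf_top A = Some a.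
Proof.
move=> [b Ab] [lba uba]; rewrite /inf_top /infimum ifF; last first.
  apply/negbTE/eqP => A0.
  have : [set (Some a : adjoin_top I) | a in A] (Some b) by exists b.
  by rewrite A0.
apply: xget_subset1; last exact: is_subset1_infimums.
split; first by move=> _ [c Ac <-]; apply: lba.
move=> [c|] cA; last by have := cA (Some b) (imageP _ Ab).
by apply: uba => e Ae; apply: (cA (Some e)); exists e.
Qed.

End AdjoinTop.

Definition meet_complete (disp : Order.disp_t) (I : porderType disp) : Prop :=
  forall S : set I, S !=set0 -> infimums S !=set0.

(** ** Coarse metrics *)

Section CoarseMetric.
Context {disp : Order.disp_t} {I : porderType disp} {X : Type}.
Variable d : X -> X -> adjoin_top I.

Definition sublevel (a : I) : set (X * X) :=
  [set xy | (d xy.1 xy.2 <= (Some a : adjoin_top I))%O].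

Definition metric_ball (z : X) (a : I) : set X :=
  rel_image (sublevel a) [set z].

Record coarse_metric : Prop := CoarseMetric {
  coarse_metric_directed :
    forall a b : I, exists c : I, (a <= c)%O /\ (b <= c)%O;
  coarse_metric_zero :
    exists2 z : I, lbound [set: I] z & forall x, d x x = Some z;
  coarse_metric_sym : forall x y, d x y = d y x;
  coarse_metric_triangle : exists Phi : I -> I,
    forall a, rel_comp (sublevel a) (sublevel a) `<=` sublevel (Phi a) }.

Definition induced_coarse_structure (E : set (set (X * X))) : Prop :=
  coarse_structure E /\ coarse_base E (range sublevel).

Definition hausdorff_metric (R S : nonempty_set X) : adjoin_top I :=
  inf_top [set a : I |
    val R `<=` \bigcup_(s in val S) metric_ball s a /\
    val S `<=` \bigcup_(r in val R) metric_ball r a].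

End CoarseMetric.

(** ** The metric attached to a base *)

Section BaseMetric.
Context {X : Type}.
Variable B : set (set (X * X)).

Definition base_sym : set (set (X * X)) :=
  [set (A `&` A^-1) `|` diagonal | A in B].

Definition base_bar : set (set (X * X)) :=
  [set \bigcap_(A in S) A | S in [set S | S !=set0 /\ S `<=` base_sym]].

Definition base_bar_type : Type := set_type base_bar.

HB.instance Definition _ := SubChoice.on base_bar_type.
HB.instance Definition _ :=
  [SubChoice_isSubPOrder of base_bar_type by <: with set_display].

Lemma base_bar_leE (C D : base_bar_type) : (C <= D)%O <-> val C `<=` val D.
Proof. by split=> /subsetPset. Qed.

Lemma base_bar_bigcap (F : set (set (X * X))) :
  F !=set0 -> F `<=` base_bar -> base_bar (\bigcap_(D in F) D).
Proof.
move=> [D0 FD0] FB.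
exists [set A | base_sym A /\ exists2 D, F D & D `<=` A].
  split; last by move=> A [].
  have [S [[A SA] SB] SE] := FB _ FD0.
  exists A; split; first exact: SB.
  by exists D0 => //; rewrite -SE; apply: bigcap_inf.
apply/seteqP; split=> [xy H D FD|xy H A [_ [D FD DA]]]; last first.
  by apply: DA; apply: H.
have [S [_ SB] SE] := FB _ FD; rewrite -SE => A SA; apply: H.
split; first exact: SB.
by exists D => //; rewrite -SE; apply: bigcap_inf.
Qed.

Definition base_bar_at (x y : X) : set (set (X * X)) :=
  [set D | base_bar D /\ D (x, y)].

Definition base_metric (x y : X) : adjoin_top base_bar_type :=
  match pselect (base_bar_at x y !=set0) with
  | left ne => Some (exist _ (\bigcap_(D in base_bar_at x y) D)
      (mem_set (base_bar_bigcap ne (fun D => @proj1 _ _))))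
  | right _ => None
  end.

End BaseMetric.

(** ** The Hausdorff coarse structure *)

Section HausdorffCoarse.
Context {X : Type}.

Definition sym_entourages (E : set (set (X * X))) : set (set (X * X)) :=
  [set A | [/\ E A, A^-1 = A & diagonal `<=` A]].

Definition hausdorff_entourage (A : set (X * X)) :
    set (nonempty_set X * nonempty_set X) :=
  [set RS | val RS.1 `<=` rel_image A (val RS.2) /\
            val RS.2 `<=` rel_image A (val RS.1)].

Definition hausdorff_coarse_structure (E : set (set (X * X))) :
    set (set (nonempty_set X * nonempty_set X)) :=
  smallest (@coarse_structure (nonempty_set X))
    (hausdorff_entourage @` sym_entourages E).

End HausdorffCoarse.

(* Main.v *)
Require Import Defs.
From mathcomp Require Import all_boot all_order.
From mathcomp Require Import boolp classical_sets.

(** Write [D_a] for [sublevel d a] and, for an entourage [A] of [X], write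
    [A^v] for [hausdorff_entourage A].

    Part (a).  If [d] is a coarse metric with values in a totally ordered set,
    its sublevels form a chain, and they are a base of the structure that [d]
    induces.  Conversely, let [B] be a totally ordered base.  Symmetrizing its
    members and closing under intersections leaves a chain of symmetric
    reflexive entourages.  By construction the set of [D] in this chain that
    contain a given pair is either empty or has a least element, which is the
    value of [base_metric B] at that pair; hence [D_a] is just [a] itself
    ([sublevel_base_metric]).  The axioms of a coarse metric and the base
    property then become statements about entourages, and they follow from the
    cofinality of the chain in [E] ([base_bar_cofinal]).

    Part (b).  The argument works for any coarse metric [d] inducing [E] whose
    values lie in a meet-complete totally ordered set.  The sets [D_a^v] and
    the sublevels of the Hausdorff metric are interleaved.  One has
    [D_a^v `<=` sublevel (hausdorff_metric d) a] directly.  The other direction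
    needs room, because the infimum defining the Hausdorff distance need not be
    attained: if some [c] lies strictly above [b], then an infimum at most [b]
    forces an admissible radius at most [c], by totality; if no such [c] exists
    then [b] is the largest radius and every admissible radius will do.  Thus
    each sublevel at [b] lies in some [D_c^v] ([sublevel_hausdorff_metric]).
    The triangle axiom is inherited from [A^v] composed with [A^v] being inside
    [(A o A)^v].  Finally, the nonempty sets contained in some sublevel of a
    coarse metric form a coarse structure
    ([coarse_metric_coarse_structure]); applied to the Hausdorff metric,
    minimality of the Hausdorff coarse structure shows that all of its elements
    are contained in such sublevels. *)

Set Implicit Arguments.
Unset Strict Implicit.
Unset Printing Implicit Defensive.

Import Order.TTheory.
Local Open Scope classical_set_scope.
Local Open Scope relation_scope.

(** * Entourages *)

Lemma rel_comp_subset (X : Type) (A A' C C' : set (X * X)) :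
  A `<=` A' -> C `<=` C' -> rel_comp A C `<=` rel_comp A' C'.
Proof. by move=> AA' CC' xz [y Axy Cyz]; exists y; [apply: AA'|apply: CC']. Qed.

Lemma inv_setE (X : Type) (A : set (X * X)) x y :
  A^-1 = A -> A (x, y) -> A (y, x).
Proof. by move=> {2}<-. Qed.

Lemma hausdorff_entourage_subset (X : Type) (A C : set (X * X)) :
  A `<=` C -> hausdorff_entourage A `<=` hausdorff_entourage C.
Proof.
move=> AC [R S] [/= RS SR]; split=> /= x.
- by move=> /RS [s Ss /AC]; exists s.
- by move=> /SR [r Rr /AC]; exists r.
Qed.

Lemma hausdorff_entourage_comp (X : Type) (A : set (X * X)) :
  rel_comp (hausdorff_entourage A) (hausdorff_entourage A) `<=`
  hausdorff_entourage (rel_comp A A).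
Proof.
move=> [R T] [S [/= RS SR] [/= ST TS]]; split=> /= x.
- by move=> /RS [s /ST [t Tt Ats] Asx]; exists t => //; exists s.
- by move=> /TS [s /SR [r Rr Ars] Asx]; exists r => //; exists s.
Qed.

Lemma hausdorff_entourage_diagonal (X : Type) (A : set (X * X))
    (R : nonempty_set X) :
  diagonal `<=` A -> hausdorff_entourage A (R, R).
Proof. by move=> dA; split=> x Rx; exists x => //; apply: dA. Qed.

Lemma hausdorff_entourage_sym (X : Type) (A : set (X * X))
    (R S : nonempty_set X) :
  hausdorff_entourage A (R, S) <-> hausdorff_entourage A (S, R).
Proof. by split=> -[]. Qed.

(** * Infima in a meet-complete ordered set *)

Lemma inf_top_le (disp : Order.disp_t) (I : porderType disp) (A : set I) (a : I) :
  meet_complete I -> A a -> (inf_top A <= (Some a : adjoin_top I))%O.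
Proof.
move=> mI Aa; have A0 : A !=set0 by exists a.
have [i iA] := mI A A0.
by rewrite (inf_topE A0 iA); apply: iA.1.
Qed.

(** The radius [c] replaces attainment of infima.  It depends on [b] only and
    not on [A]; this uniformity is what bounds a whole sublevel at once. *)
Lemma inf_top_le_attained (disp : Order.disp_t) (I : porderType disp) (b : I) :
  total (<=%O : rel I) -> meet_complete I ->
  exists c : I, forall A : set I,
    (inf_top A <= (Some b : adjoin_top I))%O -> exists2 a, A a & (a <= c)%O.
Proof.
move=> tI mI.
have A0 (A : set I) : (inf_top A <= (Some b : adjoin_top I))%O -> A !=set0.
  by move=> Ab; apply/set0P/eqP => A0; rewrite A0 inf_top0 in Ab.
have [[c cb]|bmax] := pselect (exists c : I, ~~ (c <= b)%O); last first.
  exists b => A /A0 [a Aa]; exists a => //.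
  by apply/negPn/negP => ab; apply: bmax; exists a.
exists c => A Ab; have [i iA] := mI A (A0 A Ab).
have := Ab; rewrite (inf_topE (A0 A Ab) iA) => ib.
apply: contrapT => noA; move/negP: cb; apply.
apply: (@le_trans _ _ i) => //; apply: iA.2 => a Aa.
have /orP[//|ac] := tI c a.
by case: noA; exists a.
Qed.

(** * Sublevels of a coarse metric *)

Section Sublevels.
Context {disp : Order.disp_t} {I : porderType disp} {X : Type}.
Implicit Types (d : X -> X -> adjoin_top I) (a b : I).

Lemma sublevel_le d a b : (a <= b)%O -> sublevel d a `<=` sublevel d b.
Proof. by move=> ab xy /= xya; apply: le_trans xya _. Qed.

Lemma sublevel_inv d a : coarse_metric d -> (sublevel d a)^-1 = sublevel d a.
Proof.
by move=> dm; apply/seteqP; split=> -[x y];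
  rewrite /sublevel /= (coarse_metric_sym dm).
Qed.

Lemma diagonal_sublevel d a : coarse_metric d -> diagonal `<=` sublevel d a.
Proof.
move=> dm [x y] /diagonalP <-; rewrite /sublevel /=.
by have [z zI ->] := coarse_metric_zero dm; apply: zI.
Qed.

(** The triangle axiom only composes a sublevel with itself; directedness
    reduces the composition of two different sublevels to that case. *)
Lemma coarse_metric_coarse_structure d :
  [set: X] !=set0 -> coarse_metric d ->
  coarse_structure [set A | A !=set0 /\ exists a, A `<=` sublevel d a].
Proof.
move=> [x0 _] dm; have [z _ _] := coarse_metric_zero dm.
have join a b : exists c, sublevel d a `<=` sublevel d c /\
                          sublevel d b `<=` sublevel d c.
  have [c [ac bc]] := coarse_metric_directed dm a b.
  by exists c; split; apply: sublevel_le.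
split.
- by move=> A [].
- by split; [exists (x0, x0)|exists z; apply: diagonal_sublevel].
- by move=> A C [_ [a Aa]] CA C0; split=> //; exists a; apply: subset_trans Aa.
- move=> A [[[x y] Axy] [a Aa]]; split; first by exists (y, x).
  by exists a; rewrite -(sublevel_inv a dm) => xy; apply: Aa.
- move=> A C [_ [a Aa]] [_ [b Cb]] AC0; split=> //.
  have [c [ac bc]] := join a b.
  have [Phi dPhi] := coarse_metric_triangle dm.
  exists (Phi c); apply: subset_trans (dPhi c).
  by apply: rel_comp_subset; [apply: subset_trans ac|apply: subset_trans bc].
- move=> A C [[xy Axy] [a Aa]] [_ [b Cb]]; split; first by exists xy; left.
  have [c [ac bc]] := join a b.
  by exists c => uv [/Aa/ac|/Cb/bc].
Qed.

End Sublevels.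

(** * The Hausdorff metric *)

Section HausdorffMetric.
Context {disp : Order.disp_t} {I : porderType disp} {X : Type}.
Implicit Types d : X -> X -> adjoin_top I.

Lemma hausdorff_metricE d (R S : nonempty_set X) :
  hausdorff_metric d R S =
  inf_top [set a | hausdorff_entourage (sublevel d a) (R, S)].
Proof.
have ballsE a (T : set X) :
    \bigcup_(t in T) metric_ball d t a = rel_image (sublevel d a) T.
  apply/seteqP; split=> x; first by move=> [t Tt [_ -> dtx]]; exists t.
  by move=> [t Tt dtx]; exists t => //; exists t.
by congr inf_top; apply/seteqP; split=> a; rewrite /= !ballsE.
Qed.

Lemma hausdorff_entourage_sublevel d a :
  meet_complete I ->
  hausdorff_entourage (sublevel d a) `<=` sublevel (hausdorff_metric d) a.
Proof.
move=> mI [R S] RS; rewrite /sublevel /= hausdorff_metricE.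
exact: inf_top_le.
Qed.

Lemma sublevel_hausdorff_metric d b :
  total (<=%O : rel I) -> meet_complete I ->
  exists c,
    sublevel (hausdorff_metric d) b `<=` hausdorff_entourage (sublevel d c).
Proof.
move=> tI mI; have [c cP] := inf_top_le_attained b tI mI.
exists c => -[R S]; rewrite /sublevel /= hausdorff_metricE => /cP [a RSa ac].
by apply: hausdorff_entourage_subset RSa; apply: sublevel_le.
Qed.

Lemma hausdorff_metric_coarse d :
  total (<=%O : rel I) -> meet_complete I -> coarse_metric d ->
  coarse_metric (hausdorff_metric d).
Proof.
move=> tI mI dm; split.
- exact: coarse_metric_directed dm.
- have [z zI dz] := coarse_metric_zero dm; exists z => // R.
  rewrite hausdorff_metricE; apply: inf_topE.
    by exists z; apply/hausdorff_entourage_diagonal/diagonal_sublevel.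
  split=> [a _|a]; first exact: zI.
  by apply; apply/hausdorff_entourage_diagonal/diagonal_sublevel.
- move=> R S; rewrite !hausdorff_metricE; congr inf_top.
  by apply/seteqP; split=> a /= /hausdorff_entourage_sym.
- have [Phi dPhi] := coarse_metric_triangle dm.
  have dH a : exists b, rel_comp (sublevel (hausdorff_metric d) a)
      (sublevel (hausdorff_metric d) a) `<=` sublevel (hausdorff_metric d) b.
    have [c ac] := sublevel_hausdorff_metric d a tI mI.
    exists (Phi c).
    apply: subset_trans (hausdorff_entourage_sublevel mI).
    apply: subset_trans (hausdorff_entourage_subset (dPhi c)).
    apply: subset_trans (@hausdorff_entourage_comp _ _).
    exact: rel_comp_subset.
  by have [Psi dPsi] := choice dH; exists Psi.
Qed.

End HausdorffMetric.

(** * The Hausdorff coarse structure *)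

Lemma smallest_coarse_structure (X : Type) (G : set (set (X * X))) :
  [set: X] !=set0 -> (forall A, G A -> A !=set0) ->
  coarse_structure (smallest (@coarse_structure X) G).
Proof.
move=> [x0 _] G0.
(* An intersection of coarse structures inherits every closure property, but
   it omits the empty relation only if the family is not empty. *)
have nonempty_coarse : coarse_structure [set A : set (X * X) | A !=set0].
  split=> //; first by exists (x0, x0).
  - by move=> A [[x y] Axy]; exists (y, x).
  - by move=> A C [xy Axy] _; exists xy; left.
split.
- by move=> A; apply; split.
- by move=> F [FC _]; apply: coarse_diagonal.
- move=> A C AG CA C0 F FG.
  by apply: (coarse_subset FG.1 _ CA) => //; apply: AG.
- by move=> A AG F FG; apply: (coarse_inv FG.1); apply: AG.
- by move=> A C AG CG AC0 F FG; apply: (coarse_comp FG.1) => //;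
    [apply: AG|apply: CG].
- by move=> A C AG CG F FG; apply: (coarse_setU FG.1); [apply: AG|apply: CG].
Qed.

(** That sublevels are elements of the Hausdorff structure uses a generator
    above each of them; that they are cofinal in it uses minimality, since the
    sets below some sublevel form a coarse structure containing the generators.
    *)
Lemma hausdorff_metric_induced (disp : Order.disp_t) (I : porderType disp)
    (X : Type) (d : X -> X -> adjoin_top I) (E : set (set (X * X))) :
  [set: X] !=set0 -> total (<=%O : rel I) -> meet_complete I ->
  coarse_metric d -> induced_coarse_structure d E ->
  induced_coarse_structure (hausdorff_metric d) (hausdorff_coarse_structure E).
Proof.
move=> [x0 _] tI mI dm [EC [dE Ed]].
have setX0 : [set: X] !=set0 by exists x0.
pose R0 : nonempty_set X := SigSub (mem_set (setX0 : [set A | A !=set0] setT)).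
have H0 : [set: nonempty_set X] !=set0 by exists R0.
have HC : coarse_structure (hausdorff_coarse_structure E).
  apply: smallest_coarse_structure => // _ [A [_ _ dA] <-].
  by exists (R0, R0); apply: hausdorff_entourage_diagonal.
have Hm := hausdorff_metric_coarse tI mI dm.
split=> //; split.
- move=> _ [b _ <-]; have [c bc] := sublevel_hausdorff_metric d b tI mI.
  apply: (coarse_subset HC _ bc).
    apply: sub_gen_smallest; exists (sublevel d c) => //.
    split; [by apply: dE; exists c|exact: sublevel_inv|].
    exact: diagonal_sublevel.
  by exists (R0, R0); apply: (diagonal_sublevel b Hm).
- move=> A AH.
  have [|_ [a Aa]] :=
      AH [set A | A !=set0 /\ exists a, A `<=` sublevel (hausdorff_metric d) a].
    split; first exact: coarse_metric_coarse_structure.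
    move=> _ [C [EC' _ dC] <-]; split.
      by exists (R0, R0); apply: hausdorff_entourage_diagonal.
    have [_ [a _ <-] Ca] := Ed C EC'; exists a.
    apply: subset_trans (hausdorff_entourage_sublevel mI).
    exact: hausdorff_entourage_subset.
  by exists (sublevel (hausdorff_metric d) a) => //; exists a.
Qed.

(** * The metric attached to a totally ordered base *)

Section BaseMetric.
Context {X : Type}.
Implicit Types E B : set (set (X * X)).

Definition base_bar_mk B D (BD : base_bar B D) : base_bar_type B :=
  exist _ D (mem_set BD).

Lemma base_bar_diagonal B D : base_bar B D -> diagonal `<=` D.
Proof. by move=> [S [_ SB] <-] xy dxy A /SB [C _ <-]; right. Qed.

Lemma base_bar_inv B D : base_bar B D -> D^-1 = D.
Proof.
have symS A : base_sym B A -> A^-1 = A.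
  by move=> [C _ <-]; apply/seteqP; split=> -[x y] [[]|]; [left|right|left|right].
move=> [S [_ SB] <-].
by apply/seteqP; split=> -[x y] H A SA;
  apply: (inv_setE (symS _ (SB _ SA))); apply: H.
Qed.

Lemma base_sym_base_bar B A : base_sym B A -> base_bar B A.
Proof.
move=> BA; exists [set A]; last by rewrite bigcap_set1.
by split; [exists A|move=> _ ->].
Qed.

Lemma base_bar_total B :
  total_on B subset -> total (<=%O : rel (base_bar_type B)).
Proof.
move=> tB.
have tS A C : base_sym B A -> base_sym B C -> A `<=` C \/ C `<=` A.
  move=> [A' BA <-] [C' BC <-].
  by case: (tB _ _ BA BC) => H; [left|right] => xy [[/H ? /H ?]|]; (left + right).
move=> C D; apply/orP.
have [CD|nCD] := pselect (val C `<=` val D); first by left; apply/base_bar_leE.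
right; apply/base_bar_leE.
have [S [_ SB] SE] := set_valP C; have [T [_ TB] TE] := set_valP D.
(* Some [A] in the family of [D] fails to contain [C], hence is contained in
   every member of the family of [C]. *)
have [A TA nCA] : exists2 A, T A & ~ val C `<=` A.
  apply: contrapT => H; apply: nCD; rewrite -TE => xy Cxy A TA.
  apply: contrapT => nA; apply: H; exists A => // CA.
  by apply: nA; apply: CA.
rewrite -TE -SE => xy Txy F SF.
case: (tS F A (SB _ SF) (TB _ TA)) => [FA|]; last by apply; apply: Txy.
by case: nCA => uv; rewrite -SE => /(_ _ SF) /FA.
Qed.

Lemma base_bar_meet_complete B : meet_complete (base_bar_type B).
Proof.
move=> S [D0 SD0].
have F0 : [set val D | D in S] !=set0 by exists (val D0); exists D0.
have FB : [set val D | D in S] `<=` base_bar B.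
  by move=> _ [D _ <-]; apply: set_valP.
exists (base_bar_mk (base_bar_bigcap F0 FB)); split.
- by move=> D SD; apply/base_bar_leE => /= xy; apply; exists D.
- move=> D lD; apply/base_bar_leE => /= xy Dxy _ [C SC <-].
  by have /base_bar_leE := lD C SC; apply.
Qed.

(** The family [base_bar B] is closed under nonempty intersections, so the value
    at [(x, y)] is itself the least member containing [(x, y)]; when there is no
    such member, both sides fail. *)
Lemma base_metric_le B x y (D : base_bar_type B) :
  (base_metric B x y <= (Some D : adjoin_top (base_bar_type B)))%O <->
  val D (x, y).
Proof.
rewrite /base_metric; case: pselect => [ne|none]; last first.
  by split=> // Dxy; case: none; exists (val D); split=> //; apply: set_valP.
split.
- by move=> /base_bar_leE; apply => A [].
- move=> Dxy; apply/base_bar_leE => /= uv; apply.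
  by split=> //; apply: set_valP.
Qed.

Lemma sublevel_base_metric B (D : base_bar_type B) :
  sublevel (base_metric B) D = val D.
Proof. by apply/seteqP; split=> -[x y] /base_metric_le. Qed.

Section Base.
Context {E B : set (set (X * X))}.
Hypotheses (X_nonempty : [set: X] !=set0).
Hypotheses (E_coarse : coarse_structure E) (E_base : coarse_base E B).

Lemma base_bar_entourage D : base_bar B D -> E D.
Proof.
move=> BD; have [x0 _] := X_nonempty.
have D0 : D !=set0 by exists (x0, x0); apply: (base_bar_diagonal BD).
have [S [[A SA] SB] SE] := BD.
have [C BC CA] := SB _ SA.
apply: (@coarse_subset _ _ E_coarse (C `|` diagonal)) => //.
  by apply: coarse_setU; [|exact: E_base.1|exact: coarse_diagonal].
by rewrite -SE => xy /(_ _ SA); rewrite -CA => -[[]|]; [left|right].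
Qed.

Lemma base_bar_cofinal A : E A -> exists2 D, base_bar B D & A `<=` D.
Proof.
move=> EA.
(* A member of [B] above [A] alone may lose part of [A] when symmetrized. *)
have [C BC AC] := E_base.2 _ (coarse_setU E_coarse EA (coarse_inv E_coarse EA)).
exists ((C `&` C^-1) `|` diagonal).
  by apply: base_sym_base_bar; exists C.
by move=> [x y] Axy; left; split; apply: AC; [left|right].
Qed.

Lemma base_metric_coarse :
  total_on B subset -> coarse_metric (base_metric B).
Proof.
move=> tB; have tI := base_bar_total tB; have [x0 _] := X_nonempty.
have [D0 BD0 _] := base_bar_cofinal (coarse_diagonal E_coarse).
split.
- by move=> C D; case/orP: (tI C D) => CD; [exists D|exists C].
- have [|z [zI _]] := @base_bar_meet_complete B [set: base_bar_type B].
    by exists (base_bar_mk BD0).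
  exists z => // x.
  have : (base_metric B x x <= (Some z : adjoin_top (base_bar_type B)))%O.
    by apply/base_metric_le; apply: (base_bar_diagonal (set_valP z)).
  case: (base_metric B x x) => [D|//] Dz; congr Some.
  by apply: le_anti; apply/andP; split=> //; apply: zI.
- move=> x y; apply/le_anti/andP.
  have sym u v (D : base_bar_type B) : base_metric B u v = Some D ->
      (base_metric B v u <= (Some D : adjoin_top (base_bar_type B)))%O.
    move=> uvD; apply/base_metric_le/(inv_setE (base_bar_inv (set_valP D))).
    by apply/base_metric_le; rewrite uvD.
  have le_sym u v : (base_metric B v u <= base_metric B u v)%O.
    case uvD: (base_metric B u v) => [D|]; first exact: sym.
    by case: (base_metric B v u).
  by split.
- have dB C : exists D, rel_comp (sublevel (base_metric B) C)
      (sublevel (base_metric B) C) `<=` sublevel (base_metric B) D.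
    have [|D BD CD] := @base_bar_cofinal (rel_comp (val C) (val C)).
      have EC := base_bar_entourage (set_valP C).
      apply: coarse_comp => //; exists (x0, x0).
      by exists x0; apply: (base_bar_diagonal (set_valP C)).
    exists (base_bar_mk BD).
    by rewrite !sublevel_base_metric.
  by have [Phi dPhi] := choice dB; exists Phi.
Qed.

Lemma base_metric_induced : induced_coarse_structure (base_metric B) E.
Proof.
split=> //; split.
- move=> _ [D _ <-]; rewrite sublevel_base_metric.
  by apply: base_bar_entourage; apply: set_valP.
- move=> A /base_bar_cofinal [D BD AD]; exists D => //.
  by exists (base_bar_mk BD) => //; rewrite sublevel_base_metric.
Qed.

End Base.
End BaseMetric.

Local Close Scope relation_scope.

Theorem corollary12 (X : Type) (E : set (set (X * X)))
    (X_nonempty : [set: X] !=set0) (E_coarse : coarse_structure E) :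
  (* (a) *)
  ((exists B : set (set (X * X)), totally_ordered_base E B) <->
   (exists (disp : Order.disp_t) (I : porderType disp)
           (d : X -> X -> adjoin_top I),
      [/\ total (<=%O : rel I), meet_complete I,
          coarse_metric d & induced_coarse_structure d E])) /\
  (forall B : set (set (X * X)), totally_ordered_base E B ->
      [/\ total (<=%O : rel (base_bar_type B)),
          meet_complete (base_bar_type B),
          coarse_metric (base_metric B) &
          induced_coarse_structure (base_metric B) E]) /\
  (* (b) *)
  (forall B : set (set (X * X)), totally_ordered_base E B ->
      coarse_metric (hausdorff_metric (base_metric B)) /\
      induced_coarse_structure (hausdorff_metric (base_metric B))
        (hausdorff_coarse_structure E)).
Proof.
have base_metricP (B : set (set (X * X))) : totally_ordered_base E B ->
    [/\ total (<=%O : rel (base_bar_type B)), meet_complete (base_bar_type B),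
        coarse_metric (base_metric B) &
        induced_coarse_structure (base_metric B) E].
  move=> [EB tB]; split.
  - exact: base_bar_total.
  - exact: base_bar_meet_complete.
  - exact: (base_metric_coarse X_nonempty E_coarse EB).
  - exact: base_metric_induced.
split; [split|split=> //].
- move=> [B /base_metricP dP].
  by exists set_display, (base_bar_type B), (base_metric B).
- move=> [disp [I [d [tI _ _ [_ dE]]]]]; exists (range (sublevel d)).
  split=> // _ _ [a _ <-] [b _ <-].
  by case/orP: (tI a b) => /sublevel_le; [left|right].
- move=> B /base_metricP [tI mI dm dE].
  by split; [apply: hausdorff_metric_coarse|apply: hausdorff_metric_induced].
Qed.
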